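(* For every $n\in\mathbb N$ there exists $k(n)\in\mathbb N$ such that whenever $D$ is a digraph with an end $\omega$ and $\mathcal R$ is a set of at least $k(n)$ pairwise edge-disjoint rays in $\omega$, there is a weak immersion in $D$ of the hexagonal grid of width $n$ or of the circular grid of width $n$ such that each of its rays $R_i$ (from the definition of these grids) corresponds to a ray from $\mathcal R$.
   Context: A ray is an orientation of a one-way infinite path with every edge oriented towards infinity; an anti-ray one with every edge oriented away from infinity; dipath = directed path. For rays or anti-rays $Q,R$ write $Q\le R$ if there are infinitely many pairwise disjoint $Q$--$R$ dipaths and $Q\sim R$ if $Q\le R$ and $R\le Q$; ends are the $\sim$-classes. Let $R_1,\ldots,R_n$ be pairwise disjoint rays, $R_i=r^i_1r^i_2\ldots$. The hexagonal grid of width $n$ is $\bigcup_{i=1}^nR_i$ together with the edges $r^i_jr^{i+1}_j$ for all pairs $(i,j)$ with $i\equiv j\equiv1\pmod 2$ and $j\equiv1\pmod4$, or $i\equiv j\equiv0\pmod2$ and $j\equiv2\pmod4$, and the edges $r^{i+1}_jr^i_j$ for all pairs $(i,j)$ with $i\equiv j\equiv1\pmod2$ and $j\equiv3\pmod4$, or $i\equiv j\equiv0\pmod2$ and $j\equiv0\pmod4$ (where $1\le i<n$). The circular grid of width $n$ is $\bigcup_{i=1}^nR_i$ together with the edges $r^i_{j+1}r^{i+1}_j$ for all odd $j$ and $i\in\{2,\ldots,n-1\}$, the edges $r^1_jr^2_j$ for all odd $j$, and the edges $r^n_jr^1_j$ for all even $j$. A weak immersion of a digraph $H$ in $D$ is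 a map $\varphi$ on $V(H)\cup E(H)$ such that $\varphi|_{V(H)}$ is injective into $V(D)$ and each edge $uv\in E(H)$ is mapped to a $\varphi(u)$--$\varphi(v)$ dipath in $D$, with $\varphi(e),\varphi(f)$ edge-disjoint for distinct edges $e,f$. *)

(* Defs.v *)
From mathcomp Require Import all_boot.
Set Implicit Arguments.
Unset Strict Implicit.
Unset Printing Implicit Defensive.

Section Digraphs.
Variables (V E : Type) (tail head : E -> V).

(* A one-way infinite path all of whose edges are oriented the same way:
   a ray (odir = true: edge oe i goes from ov i to ov (i+1)) or an anti-ray
   (odir = false: edge oe i goes from ov (i+1) to ov i). *)
Record oray := ORay {
  odir : bool;
  ov : nat -> V;
  oe : nat -> E;
  ov_inj : injective ov;
  oe_ok : forall i, if odir then tail (oe i) = ov i /\ head (oe i) = ov i.+1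
                    else tail (oe i) = ov i.+1 /\ head (oe i) = ov i }.

Definition is_ray (Q : oray) : Prop := odir Q = true.

Record dipath := DiPath {
  plen : nat;
  pv : nat -> V;
  pe : nat -> E;
  pv_inj : forall s t, s <= plen -> t <= plen -> pv s = pv t -> s = t;
  pe_ok : forall t, t < plen -> tail (pe t) = pv t /\ head (pe t) = pv t.+1 }.

Definition in_oray (Q : oray) (x : V) : Prop := exists i, ov Q i = x.
Definition edge_of_oray (Q : oray) (e : E) : Prop := exists i, oe Q i = e.
Definition in_path (P : dipath) (x : V) : Prop := exists2 t, t <= plen P & pv P t = x.
Definition edge_of_path (P : dipath) (e : E) : Prop :=
  exists2 t, t < plen P & pe P t = e.

Definition QR_path (Q R : oray) (P : dipath) : Prop :=
  in_oray Q (pv P 0) /\ in_oray R (pv P (plen P)) /\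
  (forall t, t <= plen P -> in_oray Q (pv P t) -> t = 0) /\
  (forall t, t <= plen P -> in_oray R (pv P t) -> t = plen P).

Definition vdisjoint (P P' : dipath) : Prop :=
  forall x, in_path P x -> in_path P' x -> False.
Definition edisjoint (P P' : dipath) : Prop :=
  forall e, edge_of_path P e -> edge_of_path P' e -> False.

Definition oray_le (Q R : oray) : Prop :=
  exists Ps : nat -> dipath,
    (forall m, QR_path Q R (Ps m)) /\
    (forall m m', m <> m' -> vdisjoint (Ps m) (Ps m')).

Definition oray_equiv (Q R : oray) : Prop := oray_le Q R /\ oray_le R Q.

Definition is_end (w : oray -> Prop) : Prop :=
  (exists X, w X) /\ forall X, w X -> forall Y, w Y <-> oray_equiv X Y.

Definition pairwise_edge_disjoint (Rs : oray -> Prop) : Prop :=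
  forall Q R, Rs Q -> Rs R -> Q <> R ->
    forall e, edge_of_oray Q e -> edge_of_oray R e -> False.

Definition path_along (P : dipath) (Q : oray) : Prop :=
  exists m, (forall t, t <= plen P -> pv P t = ov Q (m + t)) /\
            (forall t, t < plen P -> pe P t = oe Q (m + t)).

(* A weak immersion of the grid G (vertex set 'I_n * nat, where (i, j)
   stands for r^{i+1}_{j+1}; G u v means G has the edge u -> v) in D, such
   that each ray R_{i+1} of the grid is mapped along a ray sigma i taken
   from Rs (distinct grid rays to distinct rays of Rs). *)
Definition weak_immersion_along (n : nat)
    (G : 'I_n * nat -> 'I_n * nat -> Prop) (Rs : oray -> Prop) : Prop :=
  exists (phi : 'I_n * nat -> V) (P : 'I_n * nat -> 'I_n * nat -> dipath)
         (sigma : 'I_n -> oray),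
    injective phi /\
    (forall u v, G u v -> pv (P u v) 0 = phi u /\ pv (P u v) (plen (P u v)) = phi v) /\
    (forall u v u' v', G u v -> G u' v' -> (u, v) <> (u', v') ->
        edisjoint (P u v) (P u' v')) /\
    injective sigma /\ (forall i, Rs (sigma i)) /\
    (forall (i : 'I_n) (j : nat), path_along (P (i, j) (i, j.+1)) (sigma i)).

End Digraphs.

(* Grids.  A vertex (i, j) : 'I_n * nat is r^a_b with a = i+1, b = j+1. *)
Definition hex_grid (n : nat) (u v : 'I_n * nat) : Prop :=
  let a := (nat_of_ord u.1).+1 in let b := u.2.+1 in
  let c := (nat_of_ord v.1).+1 in let d := v.2.+1 in
  (a = c /\ d = b.+1) \/
  (c = a.+1 /\ d = b /\
    ((odd a /\ odd b /\ b %% 4 = 1) \/ (~~ odd a /\ ~~ odd b /\ b %% 4 = 2))) \/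
  (a = c.+1 /\ d = b /\
    ((odd c /\ odd b /\ b %% 4 = 3) \/ (~~ odd c /\ ~~ odd b /\ b %% 4 = 0))).

Definition circ_grid (n : nat) (u v : 'I_n * nat) : Prop :=
  let a := (nat_of_ord u.1).+1 in let b := u.2.+1 in
  let c := (nat_of_ord v.1).+1 in let d := v.2.+1 in
  (a = c /\ d = b.+1) \/
  (c = a.+1 /\ b = d.+1 /\ odd d /\ 2 <= a /\ a <= n.-1) \/
  (a = 1 /\ c = 2 /\ d = b /\ odd b) \/
  (a = n /\ c = 1 /\ d = b /\ ~~ odd b).

(* Main.v *)
(** Join two rays [i -> j] if, outside every finite set of vertices, some walk
    leads from ray [i] to ray [j] without using an edge of any of the given rays.
    Cutting the dipaths between equivalent rays at their last vertex on one side
    of a bipartition of the rays and the next vertex on the other side shows that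
    this finite digraph is strongly connected.

    For a set [S] of rays that are kept as rays of the grid, all other rays may
    be used for routing, so a grid edge can be realised along any walk between
    members of [S] with inner vertices outside [S]. There must be at least one
    inner vertex: edge-disjoint rays may share vertices, and only walking along
    a ray outside [S] guarantees two distinct ends.

    A large strongly connected digraph contains a suitable [S]. If all distances
    from and to a root are small, many vertices agree in both distances, and
    shortest paths through the root join any two of them while avoiding the
    others. Otherwise there is a long dipath. A long backward jump off this
    dipath closes a long cycle, which gives the circular grid. If all backward
    jumps are short, vertices spread out along the dipath can be joined to their
    neighbours in both directions, which gives the hexagonal grid. The grid edges
    are then realised one after the other, each avoiding everything used before. *)

From Stdlib Require Import Classical ClassicalEpsilon Relations.
From Stdlib Require List.
Require Import Defs.
From mathcomp Require Import all_boot zify.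
Set Implicit Arguments.
Unset Strict Implicit.
Unset Printing Implicit Defensive.

(** * Finite digraphs: walks with inner vertices outside a selected set *)

Section Torso.
Variables (T : finType) (e : rel T).

(** Only inner vertices must lie outside [S]; the ends are unrestricted, so walks can be glued at
    any vertex outside [S]. *)
Inductive torso (S : pred T) : T -> T -> Prop :=
| torso_edge x y : e x y -> torso S x y
| torso_trans x y z : torso S x y -> ~~ S y -> torso S y z -> torso S x z.

Definition hop (S : pred T) x y :=
  exists z, [/\ ~~ S z, torso S x z & torso S z y].

Definition hex_hops n (s : 'I_n -> T) := forall i j : 'I_n, j = i.+1 :> nat ->
  hop [in codom s] (s i) (s j) /\ hop [in codom s] (s j) (s i).

Definition circ_hops n (s : 'I_n -> T) := forall i j : 'I_n,
  j = i.+1 :> nat \/ (i.+1 = n /\ j = 0 :> nat) -> hop [in codom s] (s i) (s j).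

Lemma torso_sub (S S' : pred T) x y :
  subpred S S' -> torso S' x y -> torso S x y.
Proof.
move=> sS; elim=> {x y} [x y|x y z _ IH1 Sy _ IH2]; first exact: torso_edge.
by apply: torso_trans IH1 _ IH2; apply: contra Sy => /sS.
Qed.

(** On the given path, take the part from the last [A]-vertex before the first [B]-vertex up to that
    [B]-vertex. *)
Lemma torso_crossing (A B : pred T) x y :
  connect e x y -> A x -> B y -> (forall z, A z -> ~~ B z) ->
  exists x' y', [/\ A x', B y' & torso (predU A B) x' y'].
Proof.
move=> /connectP[p ep ->] Ax Bl dAB.
pose C := exists x' y', [/\ A x', B y' & torso (predU A B) x' y'].
have H q z : path e z q -> B (last z q) -> ~~ B z ->
    C \/ exists2 y', B y' & torso (predU A B) z y'.
  elim: q z => [|u q IH] z /=; first by move=> _ ->.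
  case/andP=> ezu eq Bq Bz.
  have [Bu|Bu] := boolP (B u); first by right; exists u => //; apply: torso_edge.
  have [//|[y' By' uy']] := IH u eq Bq Bu; first by left.
  have [Au|Au] := boolP (A u); first by left; exists u, y'.
  right; exists y' => //; apply: torso_trans uy'; first exact: torso_edge.
  by rewrite /= negb_or Au.
have [//|[y' By' t]] := H p x ep Bl (dAB _ Ax).
by exists x, y'.
Qed.

(** * Selecting vertices on a long dipath *)

Section LongPath.
Variables (v : nat -> T) (L : nat).
Hypothesis v_inj : forall i j, i <= L -> j <= L -> v i = v j -> i = j.
Hypothesis v_edge : forall i, i < L -> e (v i) (v i.+1).
Hypothesis strong : forall x y, connect e x y.

Let onP := [in mkseq v L.+1].

Let onPi i : i <= L -> onP (v i).
Proof. by move=> iL; apply/mapP; exists i; rewrite ?mem_iota. Qed.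

Lemma torso_forward (S : pred T) a b : a < b -> b <= L ->
  (forall i, a < i < b -> ~~ S (v i)) -> torso S (v a) (v b).
Proof.
elim: b => // b IH ab bL HS.
have [->|nab] := eqVneq a b; first by apply/torso_edge/v_edge.
have lab : a < b by lia.
apply: (torso_trans (y := v b)); last by apply/torso_edge/v_edge.
  by apply: IH => // [|i Hi]; [lia | apply: HS; lia].
by apply: HS; lia.
Qed.

(** The vertices from [v b] on and those before it together make up the dipath, so a crossing from
    the former to the latter has its inner vertices off the dipath. *)
Lemma jump_back b : 0 < b <= L ->
  exists b' a', [/\ a' < b, b <= b', b' <= L & torso onP (v b') (v a')].
Proof.
move=> Hb.
pose A : pred T := [in [seq v i | i <- iota b (L.+1 - b)]].
pose B : pred T := [in [seq v i | i <- iota 0 b]].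
have := @torso_crossing A B (v b) (v 0) (strong _ _).
case.
- by apply: map_f; rewrite mem_iota; lia.
- by apply: map_f; rewrite mem_iota; lia.
- move=> z /mapP[i]; rewrite mem_iota => Hi ->.
  apply/negP => /mapP[j]; rewrite mem_iota => Hj /v_inj; lia.
move=> _ [_ [/mapP[b' + ->] /mapP[a' + ->] t]]; rewrite !mem_iota => Hb' Ha'.
exists b', a'; split; try lia.
apply: torso_sub t => z /= /mapP[i]; rewrite mem_iota => Hi ->.
have [ib|bi] := ltnP i b; apply/orP; [right|left];
  by apply: map_f; rewrite mem_iota; lia.
Qed.

Lemma notin_codom_comp n (g : nat -> nat) c : c <= L ->
  (forall i, i < n -> g i <= L) -> (forall i, i < n -> c <> g i) ->
  ~~ [in codom (fun i : 'I_n => v (g i))] (v c).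
Proof.
move=> cL gL cg; apply/negP => /codomP[i /v_inj H].
by apply: (cg i) => //; apply: H => //; apply: gL.
Qed.

Lemma codom_sub_onP n (g : nat -> nat) : (forall i, i < n -> g i <= L) ->
  subpred [in codom (fun i : 'I_n => v (g i))] onP.
Proof. by move=> gL x /codomP[i ->]; apply/onPi/gL. Qed.

(** Every second vertex from [v a] on is selected; the skipped vertices are the inner vertices of
    the hops, and the jump closes the cycle. *)
Lemma circ_of_long_jump n a b : a + n.*2 <= b -> b <= L ->
  torso onP (v b) (v a) -> exists2 s : 'I_n -> T, injective s & circ_hops s.
Proof.
move=> ab bL back; pose g i := a + i.*2.
have gL i : i < n -> g i <= L by rewrite /g; lia.
have out c : c <= L -> (forall i, i < n -> c <> g i) ->
    ~~ [in codom (fun i : 'I_n => v (g i))] (v c).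
  by move=> cL; apply: notin_codom_comp.
exists (fun i : 'I_n => v (g i)).
  by move=> i j /v_inj H; apply: val_inj => /=;
     have := H (gL _ (ltn_ord i)) (gL _ (ltn_ord j)); rewrite /g; lia.
move=> i j ij; exists (v (g i).+1); have := ltn_ord i; have := ltn_ord j.
move=> jn lin; split.
- by apply: out => [|k kn]; rewrite /g; lia.
- by apply/torso_edge/v_edge; rewrite /g; lia.
case: ij => [->|[iN ->]].
  have -> : g i.+1 = (g i).+2 by rewrite /g; lia.
  by apply/torso_edge/v_edge; rewrite /g; lia.
have -> : g 0 = a by rewrite /g; lia.
have back' := torso_sub (codom_sub_onP gL) back.
have [->//|nb] := eqVneq (g i).+1 b.
apply: torso_trans back'; last by apply: out => [|k kn]; rewrite /g; lia.
apply: torso_forward => // [|k Hk]; first by rewrite /g in nb *; lia.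
by apply: out => [|l ln]; rewrite /g in Hk *; lia.
Qed.

(** Forward hops follow the dipath. Backward hops chain jumps until one lands at or below [g i],
    then follow the dipath up to [g i]. As jumps are shorter than [m] and selected vertices are [2m]
    apart, no other selected vertex is met. *)
Lemma hex_of_short_jumps n m : 0 < m -> m.*2 * n.+1 <= L ->
  (forall a b, a + m <= b -> b <= L -> ~ torso onP (v b) (v a)) ->
  exists2 s : 'I_n -> T, injective s & hex_hops s.
Proof.
move=> m0 mL short; have [M EM] : exists M, M = m.*2 by exists m.*2.
rewrite -EM in mL; pose g i := M * i.+1.
have g0 : g 0 = M by rewrite /g muln1.
have gS i : g i.+1 = g i + M by rewrite /g; lia.
have gLM i : i < n -> g i + M <= L by rewrite /g; nia.
have g_lt i j : i < j -> g i + M <= g j by rewrite /g; nia.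
clearbody g.
have gL i : i < n -> g i <= L by move=> /gLM; lia.
pose S := [in codom (fun i : 'I_n => v (g i))].
have out c : c <= L -> (forall i, i < n -> c <> g i) -> ~~ S (v c).
  by move=> cL; apply: notin_codom_comp.
have between i c : c <= L -> g i < c < g i + M -> ~~ S (v c).
  move=> cL Hc; apply: out => // j jn E.
  by case: (ltngtP i j) => [/g_lt|/g_lt|ij]; rewrite -?ij in E *; lia.
have below i c : i < n -> g i < c + M -> c < g i -> ~~ S (v c).
  move=> lin; have := gL i lin; case: i lin => [|i] lin giL ic ci.
    apply: out => [|j jn]; first by lia.
    by case: j jn => [|j] jn; [|have := g_lt 0 j.+1]; lia.
  by apply: (between i); have := gS i; lia.
exists (fun i : 'I_n => v (g i)).
  move=> i j /v_inj H; apply: val_inj => /=.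
  have := H (gL _ (ltn_ord i)) (gL _ (ltn_ord j)).
  by case: (ltngtP i j) => // /g_lt; lia.
move=> i j ij; have jn := ltn_ord j.
have bL := gLM _ jn; have Mj : g j = g i + M by rewrite ij gS.
split.
  exists (v (g i).+1); split.
  - by apply: (between i); lia.
  - by apply/torso_edge/v_edge; lia.
  - by apply: torso_forward => [||k Hk]; [lia|lia|apply: (between i); lia].
have shortb b' a' : a' < b' -> b' <= L -> torso onP (v b') (v a') -> b' < a' + m.
  by move=> ? ? t; rewrite ltnNge; apply/negP => H; apply: short H _ t.
have [b Eb] : exists b, b = g j by exists (g j).
rewrite -[X in hop _ (v X)]Eb.
(* A jump over [c] that starts beyond [b] is taken directly from [b]. *)
have jump_from_b c : g i < c <= b ->
    exists a' c', [/\ a' < c, c <= c', c' < a' + m, torso S (v c') (v a') &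
      (b <= c' -> torso S (v b) (v a'))].
  move=> Hc; have [|c' [a' [a'c cc' c'L t]]] := @jump_back c; first by lia.
  have c'a : c' < a' + m by apply: shortb => //; lia.
  have t' := torso_sub (codom_sub_onP gL) t.
  exists a', c'; split=> // bc'.
  have [->//|nb] := eqVneq b c'.
  apply: torso_trans t'; last by apply: (between j); lia.
  by apply: torso_forward => // [|k Hk]; [lia | apply: (between j); lia].
(* [d] bounds the remaining distance down to [g i]; the vertex [v c] reached so far becomes the
   inner vertex of the final hop. *)
have descend d c : c <= d + g i -> g i < c < b -> torso S (v b) (v c) ->
    hop S (v b) (v (g i)).
  elim: d c => [|d IH] c cd Hc tc; first by lia.
  have Sc : ~~ S (v c) by apply: (between i); lia.
  have [|a' [c' [a'c cc' c'a t H]]] := jump_from_b c; first by lia.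
  have ta : c' < b -> torso S (v c) (v a').
    move=> c'b; have [->//|ncc] := eqVneq c c'.
    apply: torso_trans t; last by apply: (between i); lia.
    by apply: torso_forward => [||k Hk]; [lia|lia|apply: (between i); lia].
  (* A jump starting at or beyond [b] still lands above [g i], since it is shorter than [m] while
     [b] is [g i + 2m]. *)
  have [bc'|c'b] := leqP b c'.
    by apply: (IH a'); [lia|lia|exact: H].
  have [ga|ag] := ltnP (g i) a'.
    by apply: (IH a'); [lia|lia|exact: torso_trans tc Sc (ta c'b)].
  exists (v c); split=> //.
  have [<-|na] := eqVneq a' (g i); first exact: ta.
  apply: torso_trans (ta c'b) _ _; first by apply: (below i); lia.
  by apply: torso_forward => [||k Hk]; [lia|lia|apply: (below i); lia].
have [|a' [c' [a'c cc' c'a t H]]] := jump_from_b b; first by lia.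
by apply: (descend _ a' _ _ (H cc')); [exact: leq_addr | lia].
Qed.

End LongPath.

(** * Distance layers around a root, and the pigeonhole argument *)

Lemma torso_of_layers (S : pred T) (r : T) (d : T -> nat) m :
  (forall x, d x = 0 -> x = r) ->
  (forall x k, d x = k.+1 -> exists2 y, e y x & d y = k) ->
  (forall x, d x < m -> ~~ S x) ->
  forall x, x <> r -> d x <= m -> torso S r x.
Proof.
move=> d0 dS dm x; have [k Ek] : exists k, d x = k by exists (d x).
elim: k x Ek => [|k IH] x Ek xr dx; first by have := d0 _ Ek.
have [y eyx dy] := dS _ _ Ek.
have [yr|yr] := eqVneq y r; first by rewrite -yr; apply: torso_edge.
apply: torso_trans (torso_edge _ eyx); last by apply: dm; lia.
by apply: IH => //; [apply/eqP | lia].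
Qed.

(** [d] is the distance from [r]. If it reaches [L] somewhere, a repetition-free path to such a
    vertex is long enough. *)
Lemma layers_or_long_path (r : T) L : (forall x, connect e r x) ->
  (exists d : T -> nat, [/\ forall x, d x < L, forall x, d x = 0 -> x = r &
     forall x k, d x = k.+1 -> exists2 y, e y x & d y = k])
  \/ exists x p, [/\ path e x p, uniq (x :: p) & L <= size p].
Proof.
move=> conn; pose P x m := [exists p : m.-tuple T, path e r p && (last r p == x)].
have PP x p : path e r p -> last r p = x -> P x (size p).
  by move=> ep lp; apply/existsP; exists (in_tuple p); rewrite ep lp /=.
have exP x : exists m, P x m.
  by have /connectP[p ep lp] := conn x; exists (size p); apply: PP.
pose d x := ex_minn (exP x).
have [/forallP dL|H] := boolP [forall x, d x < L]; [left|right].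
  exists d; split=> // [x|x k]; rewrite {1}/d; case: ex_minnP => m.
    by move=> /existsP[p /andP[_ /eqP <-]] _ m0; subst m; rewrite [p]tuple0.
  move=> /existsP[p /andP[ep /eqP lp]] minm Em; subst m.
  case: p ep lp => p; case/lastP: p => // p y /= sp.
  rewrite rcons_path last_rcons => /andP[ep ey] yx; subst y.
  exists (last r p) => //; rewrite /d; case: ex_minnP => m.
  have sz : size p = k by move/eqP: sp; rewrite size_rcons => -[].
  move=> /existsP[q /andP[eq /eqP lq]] minm'.
  have := minm' _ (PP _ _ ep erefl); rewrite sz.
  suff : k < m.+1 by lia.
  apply: minm; have := @PP x (rcons q x); rewrite size_rcons size_tuple.
  by apply; rewrite ?last_rcons // rcons_path eq lq.
move: H; rewrite negb_forall => /existsP[x]; rewrite -leqNgt /d; case: ex_minnP => m _ minm Lm.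
have /connectP[p ep lp] := conn x.
case/shortenP: ep lp => q eq uq _ lq.
by exists r, q; split=> //; apply: leq_trans Lm (minm _ (PP _ _ eq _)).
Qed.

(** Jumps count as long from length [m = n.+1.*2] on; the bound on [size p] is [m.*2 * n.+1]. *)
Lemma hops_of_long_path n x p : (forall x y, connect e x y) ->
  path e x p -> uniq (x :: p) -> 4 * n.+1 * n.+1 <= size p ->
  (exists2 s : 'I_n -> T, injective s & hex_hops s) \/
  (exists2 s : 'I_n -> T, injective s & circ_hops s).
Proof.
move=> strong ep up szp; pose v := nth x (x :: p); pose L := size p.
have v_inj i j : i <= L -> j <= L -> v i = v j -> i = j.
  by move=> iL jL /eqP; rewrite nth_uniq // => /eqP.
have v_edge i : i < L -> e (v i) (v i.+1) by move=> iL; apply: (pathP x ep).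
case: (classic (exists a b, [/\ a + n.+1.*2 <= b, b <= L &
    torso [in mkseq v L.+1] (v b) (v a)])) => [[a [b [ab bL t]]]|nex].
  right; apply: (circ_of_long_jump v_inj v_edge _ bL t); lia.
left; apply: (hex_of_short_jumps v_inj v_edge strong (m := n.+1.*2)) => //.
  by rewrite /L; nia.
by move=> a b ab bL t; apply: nex; exists a, b.
Qed.

End Torso.

Lemma torso_converse (T : finType) (e : rel T) S x y :
  torso (fun a b => e b a) S x y -> torso e S y x.
Proof.
elim=> {x y} [x y|x y z _ IH1 Sy _ IH2]; first exact: torso_edge.
exact: torso_trans IH2 Sy IH1.
Qed.

Lemma large_fiber (T U : finType) (f : T -> U) n :
  n * #|U| < #|T| -> exists u, n < #|[set x | f x == u]|.
Proof.
move=> H; apply/existsP; apply: contraLR H; rewrite negb_exists -leqNgt => /forallP Hn.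
rewrite -sum1_card (partition_big f predT) //= mulnC -sum_nat_const.
apply: leq_sum => u _; rewrite sum1_card.
by have := Hn u; rewrite -leqNgt cardsE.
Qed.

Lemma hops_exist n : exists k, forall e : rel 'I_k, (forall x y, connect e x y) ->
  (exists2 s : 'I_n -> 'I_k, injective s & hex_hops e s) \/
  (exists2 s : 'I_n -> 'I_k, injective s & circ_hops e s).
Proof.
(* The two distances take at most [L * L] pairs of values, so some pair is shared by more than [n]
   vertices, and by at least [n] after dropping the root. *)
pose L := 4 * n.+1 * n.+1; pose k := (n * (L * L)).+1; exists k => e strong.
pose r : 'I_k := ord0.
have [[d [dL d0 dS]]|[x [p [ep up sp]]]] :=
    @layers_or_long_path _ e r L (strong r); last exact: (hops_of_long_path strong ep up sp).
pose e' : rel 'I_k := fun x y => e y x.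
have strong' x y : connect e' x y by rewrite (connect_rev e x y) /= strong.
have [[d' [dL' d0' dS']]|[x [p [ep up sp]]]] :=
    @layers_or_long_path _ e' r L (strong' r); last first.
  (* A long path of the converse digraph is read backwards. *)
  apply: (@hops_of_long_path _ _ _ (last x p) (rev (belast x p))) => //.
  - by rewrite rev_path.
  - by rewrite -rev_rcons -lastI rev_uniq.
  - by rewrite size_rev size_belast.
left; have [|[m m']] := @large_fiber _ _ (fun x => (Ordinal (dL x), Ordinal (dL' x))) n.
  by rewrite card_prod !card_ord.
set F := [set _ | _] => nF.
have nF' : n <= #|F :\ r| by have := cardsD1 r F; lia.
pose s (i : 'I_n) := enum_val (widen_ord nF' i) : 'I_k.
exists s.
  by move=> i j /enum_val_inj /(congr1 val) /= ij; apply: val_inj.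
have sF i : [/\ s i <> r, d (s i) = m & d' (s i) = m'].
  have := enum_valP (widen_ord nF' i); rewrite -/(s i) !inE => /andP[/eqP ? /eqP E].
  by case: E => <- <-.
have rS : r \notin codom s by apply/codomP => -[i /esym]; have [] := sF i.
have outd x : d x < m -> x \notin codom s.
  by move=> dx; apply/codomP => -[i xi]; have [_ E _] := sF i; rewrite xi E ltnn in dx.
have outd' x : d' x < m' -> x \notin codom s.
  by move=> dx; apply/codomP => -[i xi]; have [_ _ E] := sF i; rewrite xi E ltnn in dx.
have all_hops i j : hop e [in codom s] (s i) (s j).
  have [ri _ Ei] := sF i; have [rj Ej _] := sF j.
  exists r; split=> //.
    by apply/torso_converse/(torso_of_layers d0' dS' outd') => //; rewrite Ei.
  by apply: (torso_of_layers d0 dS outd) => //; rewrite Ej.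
by move=> i j _; split.
Qed.

(** * Extremal indices and merging of finite sets *)

Lemma last_such (P : nat -> Prop) N : P 0 ->
  exists2 t, t <= N /\ P t & forall s, t < s <= N -> ~ P s.
Proof.
move=> P0; elim: N => [|N [t [tN Pt] H]]; first by exists 0 => // s; lia.
have [PN|nPN] := classic (P N.+1).
  by exists N.+1 => // s; lia.
exists t => [|s Hs]; first by split=> //; lia.
by have [->//|sN] := eqVneq s N.+1; apply: H; lia.
Qed.

Lemma first_such (P : nat -> Prop) t N : t <= N -> P N ->
  exists2 u, t <= u <= N /\ P u & forall s, t <= s < u -> ~ P s.
Proof.
elim/ltn_ind: N => N IH tN PN.
have [[s [Hs Ps]]|nx] := classic (exists s, t <= s < N /\ P s).
  have [|||w [Hw Pw] Hmin] := IH s; [lia|lia|by []|].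
  by exists w => //; split=> //; lia.
by exists N => [|s Hs Ps]; [split=> //; lia | apply: nx; exists s].
Qed.

Lemma In_cat (X : Type) (x : X) s t :
  List.In x (s ++ t) <-> List.In x s \/ List.In x t.
Proof. exact: List.in_app_iff. Qed.

Lemma finite_uniform (X : Type) (T : finType) (R : T -> seq X -> Prop) :
  (forall t U W, List.incl U W -> R t U -> R t W) ->
  (forall t, exists U, R t U) -> exists W, forall t, R t W.
Proof.
move=> mono ex.
suff [W HW] : exists W, forall t, t \in enum T -> R t W.
  by exists W => t; apply: HW; rewrite mem_enum.
elim: (enum T) => [|t s [W HW]]; first by exists [::].
have [U HU] := ex t; exists (U ++ W) => t'; rewrite inE => /orP[/eqP ->|/HW].
  by apply: mono HU; apply: List.incl_appl.
by apply: mono; apply: List.incl_appr.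
Qed.

(** * Walks in a digraph that avoid a finite set of vertices *)

Section Reach.
Variables (V E : Type) (tail head : E -> V).
Notation oray := (oray tail head).
Notation dipath := (dipath tail head).

Definition fresh_step (A : E -> Prop) (U : seq V) x y :=
  exists2 a, A a & [/\ tail a = x, head a = y, ~ List.In x U & ~ List.In y U].

Definition reach A U := clos_refl_trans V (fresh_step A U).

Lemma reach_mono (A A' : E -> Prop) U U' x y : (forall a, A a -> A' a) ->
  List.incl U' U -> reach A U x y -> reach A' U' x y.
Proof.
move=> sA sU; elim=> {x y} [x y [a Aa [ta ha xU yU]]|x|x y z _ IH1 _ IH2].
- apply: rt_step; exists a; first exact: sA.
  by split=> // /sU.
- exact: rt_refl.
- exact: rt_trans IH1 IH2.
Qed.

Lemma reach_segment A U (v : nat -> V) (a : nat -> E) s t : s <= t ->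
  (forall i, s <= i < t -> [/\ A (a i), tail (a i) = v i & head (a i) = v i.+1]) ->
  (forall i, s <= i <= t -> ~ List.In (v i) U) -> reach A U (v s) (v t).
Proof.
move=> st; rewrite -(subnKC st); elim: (t - s) => [|d IH] Ha HU.
  by rewrite addn0; apply: rt_refl.
apply: (rt_trans _ _ _ (v (s + d))).
  by apply: IH => i Hi; [apply: Ha | apply: HU]; lia.
have [|Aa ta ha] := Ha (s + d); first by lia.
rewrite addnS; apply: rt_step; exists (a (s + d)) => //.
by split=> //; [|rewrite -addnS]; apply: HU; lia.
Qed.

Definition subpath (P : dipath) t u (tu : t <= u) (uP : u <= plen P) : dipath.
Proof.
refine (@DiPath _ _ tail head (u - t) (fun i => pv P (t + i)) (fun i => pe P (t + i)) _ _).
- by move=> i j iu ju /(@pv_inj _ _ _ _ P); lia.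
- by move=> i iu; rewrite addnS; apply: pe_ok; lia.
Defined.

Definition raypath (Q : oray) (rQ : is_ray Q) (a b : nat) : dipath.
Proof.
refine (@DiPath _ _ tail head (b - a) (fun i => ov Q (a + i)) (fun i => oe Q (a + i)) _ _).
- by move=> i j _ _ /(@ov_inj _ _ _ _ Q); lia.
- by move=> i _; have := oe_ok Q (a + i); rewrite rQ addnS.
Defined.

(** [pe] is total, so even a path of length zero needs an edge as default value. *)
Definition trivial_path (x : V) (e : E) : dipath.
Proof.
by refine (@DiPath _ _ tail head 0 (fun=> x) (fun=> e) _ _) => // -[|s] [|t].
Defined.

Definition cons_path (a : E) (P : dipath) (Pa : pv P 0 = head a)
  (nP : ~ in_path P (tail a)) : dipath.
Proof.
refine (@DiPath _ _ tail head (plen P).+1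
  (fun i => if i is j.+1 then pv P j else tail a)
  (fun i => if i is j.+1 then pe P j else a) _ _).
- move=> [|i] [|j] // iP jP; first by move=> E0; case: nP; exists j.
    by move=> E0; case: nP; exists i.
  by move/(@pv_inj _ _ _ _ P) => ->.
- by move=> [|i] iP //; apply: pe_ok.
Defined.

(** The path is built from its end; if the new first vertex already lies on it, the part before that
    vertex is cut off instead of prepending the edge. *)
Lemma reach_dipath A U x y (e0 : E) : reach A U x y -> ~ List.In x U ->
  exists P : dipath, [/\ pv P 0 = x, pv P (plen P) = y,
    forall z, in_path P z -> ~ List.In z U & forall a, edge_of_path P a -> A a].
Proof.
move=> r; elim: (clos_rt_rt1n _ _ _ _ r) => {r x y} [x|x y z [a Aa [ta ha xU yU]] _ IH] notU.
  by exists (trivial_path x e0); split=> [//|//|w [t _ <-] //|a [t]].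
have [P [P0 PL PU PA]] := IH yU.
have [[t tP Pt]|nP] := classic (in_path P (tail a)).
  exists (subpath tP (leqnn _)); split=> /=.
  - by rewrite addn0 Pt.
  - by rewrite subnKC.
  - by move=> w [s /= sP <-]; apply: PU; exists (t + s) => //; lia.
  - by move=> b [s /= sP <-]; apply: PA; exists (t + s) => //; lia.
have Pa : pv P 0 = head a by rewrite P0.
exists (cons_path Pa nP); split=> //=.
- by move=> w [[|s] /= sP <-]; [rewrite ta | apply: PU; exists s].
- by move=> b [[|s] /= sP <-] //; apply: PA; exists s.
Qed.

Definition prefix_of (Q : oray) p := List.map (ov Q) (List.seq 0 p).

Lemma in_prefix_of Q p i : i < p -> List.In (ov Q i) (prefix_of Q p).
Proof. by move=> ip; apply: List.in_map; apply/List.in_seq; lia. Qed.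

Definition vertices_of (P : dipath) := List.map (pv P) (List.seq 0 (plen P).+1).

Lemma in_vertices_of P x : in_path P x -> List.In x (vertices_of P).
Proof. by case=> t tP <-; apply: List.in_map; apply/List.in_seq; lia. Qed.

Lemma ray_avoids (Q : oray) U :
  exists p, forall i, p <= i -> ~ List.In (ov Q i) U.
Proof.
elim: U => [|x U [p IH]]; first by exists 0 => i _ [].
have [[j jx]|nj] := classic (in_oray Q x).
  exists (maxn p j.+1) => i Hi [xi|]; last by apply: IH; lia.
  have /(@ov_inj _ _ _ _ Q) : ov Q i = ov Q j by rewrite jx.
  by lia.
by exists p => i Hi [xi|]; [apply: nj; exists i | apply: IH].
Qed.

Lemma disjoint_paths_avoid (Ps : nat -> dipath) U :
  (forall m m', m <> m' -> vdisjoint (Ps m) (Ps m')) ->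
  exists m, forall x, in_path (Ps m) x -> ~ List.In x U.
Proof.
move=> dis; suff [m H] : exists m, forall i, m <= i ->
    forall x, in_path (Ps i) x -> ~ List.In x U by exists m; apply: H.
elim: U => [|y U [p IH]]; first by exists 0 => i _ x _ [].
have [[j jy]|nj] := classic (exists j, in_path (Ps j) y).
  exists (maxn p j.+1) => i Hi x xi [yx|]; last by apply: (IH i) => //; lia.
  by apply: (dis i j _ x xi); [lia | rewrite -yx].
exists p => i Hi x xi [yx|]; last exact: IH xi.
by apply: nj; exists i; rewrite yx.
Qed.

(** * The auxiliary digraph on the rays *)

Section Rays.
Variables (T : finType) (f : T -> oray).
Hypothesis f_ray : forall i, is_ray (f i).

Lemma f_edge i p : tail (oe (f i) p) = ov (f i) p /\ head (oe (f i) p) = ov (f i) p.+1.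
Proof. by have := oe_ok (f i) p; rewrite f_ray. Qed.

Definition conn (A : E -> Prop) i j := forall U, exists p q,
  [/\ ~ List.In (ov (f i) p) U, ~ List.In (ov (f j) q) U &
      reach A U (ov (f i) p) (ov (f j) q)].

(** Distinct ends are demanded because they will be images of distinct grid vertices, while
    edge-disjoint rays may share vertices. *)
Definition strict_conn (A : E -> Prop) i j := forall U, exists p q,
  [/\ ~ List.In (ov (f i) p) U, ov (f i) p <> ov (f j) q &
      reach A U (ov (f i) p) (ov (f j) q)].

(** The two walks are joined along [f w]. Avoiding a prefix makes the first walk end where [f w] has
    left [U]; avoiding a longer one makes the second start no earlier. The second also avoids the
    start of the first, so the ends differ. *)
Lemma conn_trans (A : E -> Prop) i w j : (forall p, A (oe (f w) p)) ->
  conn A i w -> conn A w j -> strict_conn A i j /\ conn A i j.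
Proof.
move=> Aw iw wj.
suff H U : exists p q, [/\ ~ List.In (ov (f i) p) U, ~ List.In (ov (f j) q) U,
    ov (f i) p <> ov (f j) q & reach A U (ov (f i) p) (ov (f j) q)].
  by split=> U; have [p [q [? ? ? ?]]] := H U; exists p, q.
have [m Hm] := ray_avoids (f w) U.
have [p [y [pU yU r1]]] := iw (prefix_of (f w) m ++ U).
have [y' [q [y'U qU r2]]] := wj (ov (f i) p :: prefix_of (f w) y ++ U).
have lmy : m <= y.
  rewrite leqNgt; apply/negP => ym; apply: yU; apply/In_cat; left.
  exact: in_prefix_of.
have lyy : y <= y'.
  rewrite leqNgt; apply/negP => ym; apply: y'U; right; apply/In_cat; left.
  exact: in_prefix_of.
exists p, q; split.
- by move=> H; apply: pU; apply/In_cat; right.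
- by move=> H; apply: qU; right; apply/In_cat; right.
- by move=> H; apply: qU; left.
apply: (rt_trans _ _ _ (ov (f w) y)).
  by apply: reach_mono r1 => //; apply: List.incl_appr.
apply: (rt_trans _ _ _ (ov (f w) y')).
  apply: (reach_segment (a := oe (f w))) => // i0 Hi; last by apply: Hm; lia.
  by have [] := f_edge w i0; split.
apply: reach_mono r2 => //.
by apply: List.incl_tl; apply: List.incl_appr.
Qed.

Definition off_rays (a : E) := forall i p, oe (f i) p <> a.

Lemma link_across_cut (X : pred T) a b : X a -> ~~ X b -> oray_le (f a) (f b) ->
  exists i j, [/\ X i, ~~ X j & conn off_rays i j].
Proof.
move=> Xa Xb [Ps [QR dis]]; apply: NNPP => nex.
(* The implications make [R] hold trivially for pairs that do not cross the cut, so under the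
   contrary assumption every pair has an obstructing set, and [W] obstructs all pairs at once. *)
pose R (ij : T * T) U := X ij.1 -> ~~ X ij.2 -> ~ exists p q,
  [/\ ~ List.In (ov (f ij.1) p) U, ~ List.In (ov (f ij.2) q) U &
      reach off_rays U (ov (f ij.1) p) (ov (f ij.2) q)].
have [||W HW] := @finite_uniform V _ R.
- move=> [i j] U W sU nU Xi Xj [p [q [pW qW r]]]; apply: nU => //.
  exists p, q; split; [by move/sU|by move/sU|].
  exact: reach_mono r.
- move=> [i j]; have [nc|] := classic (exists U, R (i, j) U); first exact: nc.
  move=> nU; case: nex.
  have [Xi|nXi] := boolP (X i); last by case: nU; exists [::] => /= Xi; rewrite Xi in nXi.
  have [Xj|nXj] := boolP (X j); first by case: nU; exists [::] => /= _; rewrite Xj.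
  exists i, j; split=> // U; apply: NNPP => H; apply: nU; exists U => _ _; exact: H.
have [m Hm] := disjoint_paths_avoid W dis.
have [[p0 P0] [[q0 PL] _]] := QR m; set P := Ps m in P0 PL Hm.
pose PX t := exists i p, X i /\ ov (f i) p = pv P t.
pose PY t := exists i p, ~~ X i /\ ov (f i) p = pv P t.
have [|t [tP [i [p [Xi Ep]]]] tmax] := @last_such PX (plen P); first by exists a, p0.
have [||u [Hu [j [q [Xj Eq]]]] umin] := @first_such PY t (plen P) => //.
  by exists b, q0.
apply: (HW (i, j) Xi Xj); exists p, q; rewrite /= Ep Eq; split.
- by apply: Hm; exists t.
- by apply: Hm; exists u => //; lia.
apply: (reach_segment (a := pe P)); first by lia.
  move=> s Hs; have [|ts hs] := @pe_ok _ _ _ _ P s; first by lia.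
  (* A ray edge on this segment would have its head on an [X]-ray after [t] or its tail on another
     ray before [u]. *)
  split=> // l r El; have [tl hl] := f_edge l r.
  rewrite El in tl hl; have [Xl|Xl] := boolP (X l).
    by apply: (tmax s.+1); [lia | exists l, r.+1; rewrite -hl hs].
  by apply: (umin s); [lia | exists l, r; rewrite -tl ts].
by move=> s Hs; apply: Hm; exists s => //; lia.
Qed.

Definition link : rel T := fun i j => excluded_middle_informative (conn off_rays i j).

Lemma linkP i j : reflect (conn off_rays i j) (link i j).
Proof. by rewrite /link; case: excluded_middle_informative => H; constructor. Qed.

(** Otherwise the rays reachable from [i] would form a cut that no link leaves. *)
Lemma link_strong : (forall i j, oray_le (f i) (f j)) -> forall i j, connect link i j.
Proof.
move=> le i j; apply/negPn/negP => nij.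
have [i' [j' [ci /negP nj /linkP l]]] :=
  @link_across_cut (connect link i) i j (connect0 _ _) nij (le i j).
exact: nj (connect_trans ci (connect1 l)).
Qed.

Section Selected.
Variables (n : nat) (s : 'I_n -> T).
Hypothesis f_disj : forall i j, i <> j -> forall p q, oe (f i) p <> oe (f j) q.

Definition off_selected (a : E) := forall i p, oe (f (s i)) p <> a.

Lemma off_selected_ray w p : w \notin codom s -> off_selected (oe (f w) p).
Proof.
by move=> ws i q; apply: f_disj => siw; move/codomP: ws; apply; exists i.
Qed.

(** Edges of an unselected ray are off all selected rays, so walks may be joined along it. *)
Lemma torso_conn i j : torso link [in codom s] i j -> conn off_selected i j.
Proof.
elim=> {i j} [i j /linkP H U|i w j _ IH1 ws _ IH2].
  have [p [q [pU qU r]]] := H U; exists p, q; split=> //.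
  by apply: reach_mono r => // a Ha l; apply: Ha.
by apply: (conn_trans _ IH1 IH2).2 => p; apply: off_selected_ray.
Qed.

Lemma hop_strict_conn i j : hop link [in codom s] i j -> strict_conn off_selected i j.
Proof.
case=> w [ws t1 t2].
apply: (conn_trans _ (torso_conn t1) (torso_conn t2)).1 => p.
exact: off_selected_ray.
Qed.

End Selected.
End Rays.
End Reach.

(** * From a schedule of connections to a weak immersion *)

Section Immersion.
Variables (V E : Type) (tail head : E -> V) (n : nat).
Notation dipath := (dipath tail head).
Variables (sigma : 'I_n -> oray tail head) (sched : nat -> 'I_n * 'I_n).
Hypothesis sigma_ray : forall i, is_ray (sigma i).
Hypothesis sched_conn : forall t, (sched t).1 <> (sched t).2 ->
  strict_conn sigma (off_rays sigma) (sched t).1 (sched t).2.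

(** [pos] records where the ends of [C] lie on the two rays. For [u = v] a single vertex suffices:
    it only places a grid vertex. *)
Definition scheduled_path (u v : 'I_n) U (C : dipath) (pos : 'I_n -> nat) :=
  [/\ pv C 0 = ov (sigma u) (pos u) /\ pv C (plen C) = ov (sigma v) (pos v),
      u <> v -> pv C 0 <> pv C (plen C),
      forall x, in_path C x -> ~ List.In x U &
      forall a, edge_of_path C a -> off_rays sigma a].

Lemma scheduled_path_exists t U :
  exists Cp, scheduled_path (sched t).1 (sched t).2 U Cp.1 Cp.2.
Proof.
have e0 := oe (sigma (sched t).1) 0.
have := @sched_conn t; case: (sched t) => u v /= Hconn.
have [<-|uv] := eqVneq u v.
  have [p Hp] := ray_avoids (sigma u) U.
  exists (trivial_path tail head (ov (sigma u) p) e0, fun=> p).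
  by split=> // [x [s _ /= <-]|a [s]] //; apply: Hp.
have [p [q [pU pq r]]] := Hconn (elimN eqP uv) U.
have [P [P0 PL PU PA]] := reach_dipath e0 r pU.
exists (P, fun i => if i == u then p else q); split=> //=.
  by rewrite eqxx eq_sym (negbTE uv).
by rewrite P0 PL.
Qed.

Definition pick_path t U := proj1_sig (constructive_indefinite_description _
  (scheduled_path_exists t U)).

Lemma pick_pathP t U :
  scheduled_path (sched t).1 (sched t).2 U (pick_path t U).1 (pick_path t U).2.
Proof.
exact: (proj2_sig (constructive_indefinite_description _
  (scheduled_path_exists t U))).
Qed.

(** Blocking prefixes of both rays, besides the path itself, forces later positions on these rays to
    be larger. *)
Fixpoint used t : seq V := if t is t'.+1 then
  let Cp := pick_path t' (used t') in
  used t' ++ vertices_of Cp.1 ++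
    prefix_of (sigma (sched t').1) (Cp.2 (sched t').1).+1 ++
    prefix_of (sigma (sched t').2) (Cp.2 (sched t').2).+1
  else [::].

Let C t := (pick_path t (used t)).1.
Let pos i t := (pick_path t (used t)).2 i.

Let usedS t : used t.+1 = used t ++ vertices_of (C t) ++
  prefix_of (sigma (sched t).1) (pos (sched t).1 t).+1 ++
  prefix_of (sigma (sched t).2) (pos (sched t).2 t).+1.
Proof. by []. Qed.

Let CP t : scheduled_path (sched t).1 (sched t).2 (used t) (C t) (pos^~ t).
Proof. exact: pick_pathP. Qed.

Let used_incl t t' : t <= t' -> List.incl (used t) (used t').
Proof.
move=> tt'; rewrite -(subnKC tt'); elim: (t' - t) => [|d IH].
  by rewrite addn0.
by rewrite addnS usedS; apply: List.incl_tran IH _; apply: List.incl_appl.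
Qed.

Let C_disjoint t t' : t <> t' -> vdisjoint (C t) (C t').
Proof.
wlog tt' : t t' / t < t' => [H ne x xt xt'|_ x xt xt'].
  have [lt|lt|//] := ltngtP t t'; first by apply: (H t t') xt xt'; lia.
  by apply: (H t' t) xt' xt; lia.
have [_ _ /(_ x xt') nx _] := CP t'; apply: nx; apply: (used_incl tt').
by rewrite usedS; apply/In_cat; right; apply/In_cat; left; apply: in_vertices_of.
Qed.

Let scheduled i t := i = (sched t).1 \/ i = (sched t).2.

Let pos_in i t : scheduled i t -> in_path (C t) (ov (sigma i) (pos i t)).
Proof.
have [[C0 CL] _ _ _] := CP t.
by case=> ->; [rewrite -C0; exists 0 | rewrite -CL; exists (plen (C t))].
Qed.

Let pos_mono i t t' : t < t' -> scheduled i t -> scheduled i t' -> pos i t < pos i t'.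
Proof.
move=> tt' it it'; rewrite ltnNge; apply/negP => le.
have [_ _ /(_ _ (pos_in it')) nx _] := CP t'; apply: nx; apply: (used_incl tt').
rewrite usedS; apply/In_cat; right; apply/In_cat; right.
apply/In_cat.
by case: it le => ->; [left|right]; apply: in_prefix_of.
Qed.

(** [tau u] is the time at which the image of the grid vertex [u] is chosen; both ends of a cross
    edge share it. *)
Variables (G : 'I_n * nat -> 'I_n * nat -> Prop) (tau : 'I_n * nat -> nat).
Variable (Rs : oray tail head -> Prop).
Hypothesis sigma_inj : injective sigma.
Hypothesis sigma_Rs : forall i, Rs (sigma i).
Hypothesis sigma_disj :
  forall i j, i <> j -> forall p q, oe (sigma i) p <> oe (sigma j) q.
Hypothesis tau_sched : forall u, scheduled u.1 (tau u).
Hypothesis tau_mono : forall i j, tau (i, j) < tau (i, j.+1).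
Hypothesis tau_cross : forall u v, G u v ->
  v = (u.1, u.2.+1) \/ (tau v = tau u /\ sched (tau u) = (u.1, v.1)).

Let tau_lt i j j' : j < j' -> tau (i, j) < tau (i, j').
Proof.
elim: j' => // j' IH; rewrite ltnS leq_eqVlt => /orP[/eqP ->|/IH lt] //.
exact: ltn_trans lt (tau_mono _ _).
Qed.

Let tau_inj i j j' : tau (i, j) = tau (i, j') -> j = j'.
Proof. by case: (ltngtP j j') => // /(tau_lt i) lt E0; rewrite E0 ltnn in lt. Qed.

Let gpos u := pos u.1 (tau u).

Let gpos_lt i j j' : j < j' -> gpos (i, j) < gpos (i, j').
Proof.
move=> lt.
exact: pos_mono (tau_lt i lt) (tau_sched (i, j)) (tau_sched (i, j')).
Qed.

Let phi u := ov (sigma u.1) (gpos u).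

(** Scheduled paths of different times are disjoint, so equal images have equal times; vertices of
    different rays placed at one time are the two distinct ends of one path. *)
Let phi_inj : injective phi.
Proof.
move=> [i j] [i' j'] eqphi.
have inC u : in_path (C (tau u)) (phi u) by apply: pos_in.
have Et : tau (i, j) = tau (i', j').
  apply: NNPP => ne; apply: (C_disjoint ne) (inC (i, j)) _.
  by rewrite eqphi.
have [ii|ii] := eqVneq i i'; first by rewrite -ii in Et *; rewrite (tau_inj Et).
have [[C0 CL] Cne _ _] := CP (tau (i, j)).
have /= Hi := tau_sched (i, j); have /= := tau_sched (i', j').
rewrite /phi /gpos /= -Et in eqphi * => Hi'.
case: Hi Hi' => Ei [] Ei'; first by rewrite Ei Ei' eqxx in ii.
- by case: Cne; [move=> E0; rewrite Ei Ei' E0 eqxx in ii | rewrite C0 CL -Ei -Ei'].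
- by case: Cne; [move=> E0; rewrite Ei Ei' E0 eqxx in ii | rewrite C0 CL -Ei -Ei'].
- by rewrite Ei Ei' eqxx in ii.
Qed.

(** Ray edges become ray segments and cross edges become scheduled paths. Segments of one ray do not
    overlap, scheduled paths use no edge of the rays [sigma], and each time serves a single cross
    edge. *)
Lemma immersion_of_schedule : weak_immersion_along G Rs.
Proof.
pose ray_edge u v := v == (u.1, u.2.+1) :> 'I_n * nat.
pose P u v := if ray_edge u v then raypath (sigma_ray u.1) (gpos u) (gpos v)
              else C (tau u).
have cross u v : G u v -> ~~ ray_edge u v ->
    tau v = tau u /\ sched (tau u) = (u.1, v.1).
  by move=> /tau_cross[->|//]; rewrite /ray_edge eqxx.
have oe_inj i p q : oe (sigma i) p = oe (sigma i) q -> p = q.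
  move=> eqe; have [tp _] := f_edge sigma_ray i p.
  have [tq _] := f_edge sigma_ray i q.
  by apply: (@ov_inj _ _ _ _ (sigma i)); rewrite -tp -tq eqe.
have off u t a : edge_of_path (raypath (sigma_ray u.1) (gpos u) t) a ->
    forall t', edge_of_path (C t') a -> False.
  move=> [s _ /= Ea] t' Ca; have [_ _ _ /(_ _ Ca) H] := CP t'.
  exact: H Ea.
exists phi, P, sigma; split; first exact: phi_inj.
split.
  move=> u v Guv; rewrite /P; case: ifPn => [/eqP -> /=|nr].
    rewrite addn0 /phi /= subnKC //; apply: ltnW.
    by case: u {Guv} => i j; apply: gpos_lt.
  have [tv Es] := cross _ _ Guv nr; have [[C0 CL] _ _ _] := CP (tau u).
  by rewrite Es /= in C0 CL; rewrite /phi /gpos tv.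
split; last first.
  split=> //; split=> // i j; rewrite /P /ray_edge eqxx /=.
  by exists (gpos (i, j)).
move=> u v u' v' Guv Guv' ne a; rewrite /P.
case: ifPn => [/eqP Ev|nr]; case: ifPn => [/eqP Ev'|nr'].
- move=> [x /= Hx Ex] [x' /= Hx' Ex']; subst v v'.
  case: u u' ne Hx Ex Hx' Ex' {Guv Guv'} => i j [i' j'] /= ne Hx Ex Hx' Ex'.
  have [ii|/eqP ii] := eqVneq i i'; last first.
    by apply: (sigma_disj ii (p := gpos (i, j) + x) (q := gpos (i', j') + x')); rewrite Ex Ex'.
  subst i'; have := oe_inj _ _ _ (etrans Ex (esym Ex')) => Exx.
  have [jj|jj|jj] := ltngtP j j'; last by apply: ne; rewrite jj.
    have : gpos (i, j.+1) <= gpos (i, j').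
      by move: jj; rewrite leq_eqVlt => /orP[/eqP ->|/(gpos_lt i)/ltnW].
    by lia.
  have : gpos (i, j'.+1) <= gpos (i, j).
    by move: jj; rewrite leq_eqVlt => /orP[/eqP ->|/(gpos_lt i)/ltnW].
  by lia.
- by move=> /off H /H.
- by move=> Ha /off H; apply: H Ha.
have [tv Es] := cross _ _ Guv nr; have [tv' Es'] := cross _ _ Guv' nr'.
have [Et|/eqP nt] := eqVneq (tau u) (tau u').
  rewrite Et in tv Es; rewrite Es in Es'; case: Es' => E1 E2; case: ne.
  case: u v u' v' Et tv tv' E1 E2 {Guv Guv' nr nr' Es} => i j [k l] [i' j'] [k' l'] /=.
  move=> Et tv tv' E1 E2; subst i' k'; rewrite -tv' in tv.
  by rewrite (tau_inj Et) (tau_inj tv).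
move=> [x xC Ex] [y yC Ey]; apply: (C_disjoint nt (x := tail a)).
  by exists x; [exact: ltnW | rewrite -Ex; have [->] := pe_ok xC].
by exists y; [exact: ltnW | rewrite -Ey; have [->] := pe_ok yC].
Qed.

End Immersion.

(** * Schedules for the hexagonal and the circular grid *)

Section GridSchedules.
Variables (V E : Type) (tail head : E -> V) (n : nat).
Variables (sigma : 'I_n.+1 -> oray tail head) (Rs : oray tail head -> Prop).
Hypothesis sigma_ray : forall i, is_ray (sigma i).
Hypothesis sigma_inj : injective sigma.
Hypothesis sigma_Rs : forall i, Rs (sigma i).
Hypothesis sigma_disj :
  forall i j, i <> j -> forall p q, oe (sigma i) p <> oe (sigma j) q.

Let N := n.+2.

Let decode b c : c < N -> (b * N + c) %/ N = b /\ (b * N + c) %% N = c.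
Proof.
by move=> cN; rewrite divnMDl // divn_small // addn0 modnMDl modn_small.
Qed.

(* Time [b * N + c] treats the edge of row [b] between the rays [c.-1] and [c];
   for [c = 0] and [c = n.+1] it degenerates to a single ray. *)
Definition hex_time (u : 'I_n.+1 * nat) :=
  u.2 * N + (if odd u.1 == odd u.2 then u.1.+1 else u.1).

(** Rows count from 0 here, so residues 0 and 1 modulo 4 are the rows whose cross edges lead to the
    higher ray. Truncation by [.-1] and [minn] yields the degenerate slots. *)
Definition hex_sched t : 'I_n.+1 * 'I_n.+1 :=
  let c := t %% N in
  let i := inord c.-1 in let j := inord (minn c n) in
  if t %/ N %% 4 < 2 then (i, j) else (j, i).

Lemma hex_immersion :
  (forall i j : 'I_n.+1, j = i.+1 :> nat ->
    strict_conn sigma (off_rays sigma) i j /\ strict_conn sigma (off_rays sigma) j i) ->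
  weak_immersion_along (hex_grid (n := n.+1)) Rs.
Proof.
move=> conn.
have cN (u : 'I_n.+1 * nat) : (if odd u.1 == odd u.2 then u.1.+1 else u.1 : nat) < N.
  by have := ltn_ord u.1; rewrite /N; case: ifP; lia.
apply: (@immersion_of_schedule _ _ _ _ _ sigma hex_sched _ _ _ hex_time) => //.
- move=> t; rewrite /hex_sched; set c := t %% N.
  have cN' : c < N by rewrite ltn_mod.
  have c1 : c.-1 < n.+1 by rewrite /N in cN'; lia.
  have c2 : minn c n < n.+1 by lia.
  have H : (inord c.-1 : 'I_n.+1) <> inord (minn c n) :> 'I_n.+1 ->
      (inord (minn c n) : 'I_n.+1) = (inord c.-1 : 'I_n.+1).+1 :> nat.
    move=> ne; rewrite !inordK //.
    have : c.-1 <> minn c n by move=> E0; apply: ne; rewrite E0.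
    by rewrite /N in cN'; lia.
  case: ifP => _ /= ne; first by have [] := conn _ _ (H ne).
  by have [] := conn _ _ (H (nesym ne)).
- move=> u; have [Eb Ec] := decode u.2 (cN u).
  rewrite /hex_sched /hex_time Eb Ec.
  set i := inord _; set j := inord _; suff [] : u.1 = i \/ u.1 = j.
  + by case: ifP => _ /=; [left|right].
  + by case: ifP => _ /=; [right|left].
  have := ltn_ord u.1; rewrite /i /j; case: ifP => _ lun; [left|right];
    by apply: val_inj; rewrite /= inordK; lia.
- move=> i j; rewrite /hex_time /=; have := ltn_ord i.
  by rewrite /N; case: ifP; case: ifP; lia.
move=> [i j] [k l]; have jl := decode j (cN (i, j)); move: jl => /= [Eb Ec].
rewrite /hex_grid /= => -[[ik jl]|H]; [left|right].
  by congr pair; [apply: val_inj => /=|]; lia.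
have lin := ltn_ord i; have lkn := ltn_ord k.
rewrite /hex_sched /hex_time /= Eb Ec.
case: H => [] [ik [jl H]].
  have -> : l = j by lia.
  have Ek : k = i.+1 :> nat by lia.
  have -> : (odd i == odd j) = true by case: H; lia.
  have -> : (odd k == odd j) = false by rewrite Ek; case: H; lia.
  have -> : j %% 4 < 2 by case: H; lia.
  split; first by rewrite Ek.
  by congr pair; apply: val_inj; rewrite /= inordK; lia.
have -> : l = j by lia.
have Ei : i = k.+1 :> nat by lia.
have -> : (odd k == odd j) = true by case: H; lia.
have -> : (odd i == odd j) = false by rewrite Ei; case: H; lia.
have -> : (j %% 4 < 2) = false by case: H; lia.
split; first by rewrite Ei.
by congr pair; apply: val_inj; rewrite /= inordK; lia.
Qed.

(* In round [m] the ray [i] meets the edge coming from [i.-1] at row [2m] and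
   the one going to [i.+1] at row [2m+1]; the ray [0] meets them the other way
   round. Time [m * N + c] treats the edge from [c.-1] to [c]. *)
Definition circ_time (u : 'I_n.+1 * nat) :=
  u.2./2 * N + (if u.1 == 0 :> nat then (if odd u.2 then n.+1 else 1)
                else u.1 + odd u.2).

(** The slot [c = n.+1] gives the closing edge from the last ray to ray 0; [c = 0] is degenerate. *)
Definition circ_sched t : 'I_n.+1 * 'I_n.+1 :=
  let c := t %% N in (inord c.-1, inord (c %% n.+1)).

Lemma circ_immersion : 0 < n ->
  (forall i j : 'I_n.+1, j = i.+1 :> nat \/ (i.+1 = n.+1 /\ j = 0 :> nat) ->
    strict_conn sigma (off_rays sigma) i j) ->
  weak_immersion_along (circ_grid (n := n.+1)) Rs.
Proof.
move=> n0 conn.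
pose cc (u : 'I_n.+1 * nat) := if u.1 == 0 :> nat then (if odd u.2 then n.+1 else 1)
                else u.1 + odd u.2.
have cN u : cc u < N.
  by have := ltn_ord u.1; rewrite /cc /N; do 2?case: ifP; lia.
have modc c : c < N -> c %% n.+1 = if c == n.+1 then 0 else c.
  by rewrite /N => lc; case: eqP => [->|ne]; [rewrite modnn | rewrite modn_small //; lia].
apply: (@immersion_of_schedule _ _ _ _ _ sigma circ_sched _ _ _ circ_time) => //.
- move=> t; rewrite /circ_sched /=; set c := t %% N.
  have cN' : c < N by rewrite ltn_mod.
  have c1 : c.-1 < n.+1 by rewrite /N in cN'; lia.
  have c2 : c %% n.+1 < n.+1 by rewrite ltn_mod.
  move=> ne; have ne' : c.-1 <> c %% n.+1 by move=> E0; apply: ne; rewrite E0.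
  apply: conn; rewrite !inordK //.
  move: ne'; rewrite modc //; rewrite /N in cN'.
  by case: (c =P n.+1); lia.
- move=> u; have [Eb Ec] := decode u.2./2 (cN u).
  rewrite /circ_sched /circ_time -/(cc u) Ec /= modc //.
  have := ltn_ord u.1; rewrite /cc => lun.
  by case: ifP => i0; case: (odd u.2); [right|left|left|right]; apply: val_inj;
    rewrite /= inordK; do ?case: (_ =P n.+1); lia.
- move=> i j; rewrite /circ_time /=; have := ltn_ord i.
  by rewrite /N uphalf_half; case: (odd j); case: eqP; rewrite /=; lia.
move=> [i j] [k l]; have [Eb Ec] := decode j./2 (cN (i, j)).
have lin := ltn_ord i; have lkn := ltn_ord k.
rewrite /circ_grid /= => -[[ik jl]|H]; [left|right].
  by congr pair; [apply: val_inj => /=|]; lia.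
rewrite /circ_sched /circ_time -/(cc (i, j)) -/(cc (k, l)) /= Ec modc //.
(* Both ends of a cross edge lie in the same round and the same slot, and that slot schedules
   exactly their two rays. *)
suff [Ecc [Ei Ek]] : j./2 = l./2 /\ cc (k, l) = cc (i, j) /\
    ((cc (i, j)).-1 = i /\ (if cc (i, j) == n.+1 then 0 else cc (i, j)) = k).
  rewrite Ecc Ei; split=> //; case: Ek => Ek1 Ek2.
  by congr pair; apply: val_inj; rewrite /= inordK ?Ek1 ?Ek2.
rewrite /cc /=; case: H => [[ki [jl [ol [i1 i2]]]]|[[i0 [k1 [jl oj]]]|[iN [k0 [jl oj]]]]].
- have -> : (i == 0 :> nat) = false by lia.
  have -> : (k == 0 :> nat) = false by lia.
  have -> : odd j by lia.
  have -> : odd l = false by lia.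
  by split; [lia|split; [lia|split; [lia|case: eqP; lia]]].
- have -> : (i == 0 :> nat) = true by lia.
  have -> : (k == 0 :> nat) = false by lia.
  have -> : odd j = false by lia.
  have -> : odd l = false by lia.
  by split; [lia|split; [lia|split; [lia|case: eqP; lia]]].
have -> : (i == 0 :> nat) = false by lia.
have -> : (k == 0 :> nat) = true by lia.
have -> : odd j by lia.
have -> : odd l by lia.
by split; [lia|split; [lia|split; [lia|case: eqP; lia]]].
Qed.

End GridSchedules.

Theorem theorem6p2 :
  forall n : nat, exists k : nat,
  forall (V E : Type) (tail head : E -> V)
         (w : oray tail head -> Prop) (Rs : oray tail head -> Prop),
    is_end w ->
    (forall Q, Rs Q -> is_ray Q /\ w Q) ->
    pairwise_edge_disjoint Rs ->
    (exists f : 'I_k -> oray tail head, injective f /\ forall i, Rs (f i)) ->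
    weak_immersion_along (hex_grid (n:=n)) Rs \/
    weak_immersion_along (circ_grid (n:=n)) Rs.
Proof.
(* Width zero is the empty grid; it is separate because the schedules use [inord], which needs a
   nonempty ordinal type. *)
move=> [|n].
  exists 0 => V E tail head w Rs _ _ _ _; left.
  have no (u : 'I_0 * nat) (X : Type) : X by case: u => -[].
  have noi (i : 'I_0) (X : Type) : X by case: i.
  exists (fun u => no u _), (fun u _ => no u _), (fun i => noi i _).
  by split; [|split; [|split; [|split; [|split]]]] => u; first [exact: (no u) | exact: (noi u)].
have [k Hk] := hops_exist n.+1; exists k => V E tail head w Rs [_ w_end] Rs_w Rs_disj.
case=> f [f_inj f_Rs].
have f_ray i : is_ray (f i) by have [] := Rs_w _ (f_Rs i).
have f_le i j : oray_le (f i) (f j).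
  have [_ wi] := Rs_w _ (f_Rs i); have [_ wj] := Rs_w _ (f_Rs j).
  by have [/(_ wj) [] //] := w_end _ wi (f j).
have f_disj i j : i <> j -> forall p q, oe (f i) p <> oe (f j) q.
  move=> ij p q E0; apply: (Rs_disj _ _ (f_Rs i) (f_Rs j) _ (oe (f i) p)).
  - by move/f_inj.
  - by exists p.
  - by exists q.
have conn s i j : hop (link f) [in codom s] (s i) (s j) ->
    strict_conn (fun l : 'I_n.+1 => f (s l)) (off_rays (fun l => f (s l))) i j.
  by move=> h; apply: hop_strict_conn h.
have [[s s_inj Hs]|[s s_inj Hs]] := Hk _ (link_strong f_ray f_le).
  left; apply: (hex_immersion (sigma := fun l => f (s l))) => //.
  - by move=> i j /f_inj/s_inj.
  - by move=> i j ij p q; apply: f_disj => /s_inj.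
  - by move=> i j ij; have [] := Hs _ _ ij; split; apply: conn.
(* In width one the circular grid has loops, but the hexagonal grid is a single ray and asks for no
   connections. *)
have [n0|n0] := posnP n; last first.
  right; apply: (circ_immersion (sigma := fun l => f (s l))) => //.
  - by move=> i j /f_inj/s_inj.
  - by move=> i j ij p q; apply: f_disj => /s_inj.
  - by move=> i j ij; apply: conn; apply: Hs.
left; apply: (hex_immersion (sigma := fun l => f (s l))) => //.
- by move=> i j /f_inj/s_inj.
- by move=> i j ij p q; apply: f_disj => /s_inj.
- by move=> i j; have := ltn_ord i; have := ltn_ord j; lia.
Qed.
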